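(* Let $p$ be an odd prime and let $0<\alpha\le 1$ be fixed. There exist functions $a(n),b(n),c(n)$, depending only on $p$ and $\alpha$ and tending to $0$ as $n\to\infty$, such that the following holds. Let $S\subseteq \mathbb{F}_{p^n}$ be a set such that $\Lambda_3(1_S)$ is minimal among all subsets $S'\subseteq\mathbb{F}_{p^n}$ satisfying $|S'|\ge \alpha p^n$, and $|S|\ge \alpha p^n$. Then there exist a subgroup (equivalently, $\mathbb{F}_p$-subspace) $W\le \mathbb{F}_{p^n}$ with $\dim W\ge n-a(n)\,n$ and a set $A\subseteq\mathbb{F}_{p^n}$ with $|A|\le p^{b(n)\,n}$ such that $$|S\,\Delta\,(A+W)|\le c(n)\,p^n,$$ where $\Delta$ denotes symmetric difference. (In the paper's notation: $\dim W=n-o(n)$, $|A|=p^{o(n)}$, $|S\,\Delta\,(A+W)|=o(p^n)$ as $n\to\infty$ with $p,\alpha$ fixed.)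
   Context: $\mathbb{F}_{p^n}$ is regarded as an $n$-dimensional vector space over $\mathbb{F}_p$. For $f:\mathbb{F}_{p^n}\to[0,1]$, $\Lambda_3(f)=p^{-2n}\sum_{m,d\in\mathbb{F}_{p^n}} f(m)f(m+d)f(m+2d)$; $1_S$ is the indicator function of $S$, so $\Lambda_3(1_S)$ is the normalized number of (possibly trivial) three-term arithmetic progressions in $S$. *)

(* Defs.v *)
From HB Require Import structures.
From mathcomp Require Import all_boot all_order all_algebra all_field.
From mathcomp Require Import all_classical all_reals all_analysis.
Set Implicit Arguments. Unset Strict Implicit. Unset Printing Implicit Defensive.
Import Order.TTheory GRing.Theory Num.Theory.
Local Open Scope ring_scope.

(* F_{p^n}, viewed as an n-dimensional vector space over F_p, is modelled
   as the row space 'rV['F_p]_n. *)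
Notation Fpn p n := 'rV['F_p]_n.

Definition Lambda3 (R : realType) (p n : nat) (S : {set Fpn p n}) : R :=
  ((p ^ n)%:R ^+ 2)^-1 *
  \sum_(m : Fpn p n) \sum_(d : Fpn p n)
     ((m \in S)%:R * ((m + d) \in S)%:R * ((m + d *+ 2) \in S)%:R).

Definition symdiff (T : finType) (A B : {set T}) : {set T} :=
  (A :\: B) :|: (B :\: A).

Definition sumset (p n : nat) (A : {set Fpn p n}) (W : {vspace Fpn p n})
  : {set Fpn p n} := [set a + w | a in A, w in [pred x | x \in W]].

(* Main.v *)
Require Import Defs.
From HB Require Import structures.
From mathcomp Require Import all_boot all_order all_algebra all_field.
From mathcomp Require Import all_classical all_reals all_analysis.
From mathcomp Require Import complex ring lra.
Import Order.TTheory GRing.Theory Num.Theory.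
Local Open Scope ring_scope.
Set Implicit Arguments. Unset Strict Implicit. Unset Printing Implicit Defensive.

(* Write T(f) for the number of three-term progressions weighted by f, and let
   f be the average of 1_S over the cosets of a subspace W on which all large
   Fourier coefficients of 1_S are trivial; W has bounded codimension, and
   T(f) <= T(1_S) + o(p^2n). Put phi = min(f, 1 - f) and let l be a linear form
   that is not constant on W. The function F = f + phi * (1/p - [l = 0]) takes
   values in [0, 1] and has the same mean as f. Averaging over W kills all mixed
   terms in T(F), which leaves T(F) = T(f) - (1 - 1/p) T(phi) / p^2.
   Moving mass between two points along a direction in which T is concave rounds
   F to a set that is no smaller and has almost no more progressions. So
   minimality of S forces T(phi) = o(p^2n), hence (Varnavides) sum phi = o(p^n).
   But sum phi is the distance from S to the union of the cosets where
   f >= 1/2. *)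

(** * Fourier analysis on F_p^n *)

(* Lambda3 without its normalization, and for three different functions. *)
Definition ap3 (K : pzRingType) (U : finZmodType) (f g h : U -> K) : K :=
  \sum_m \sum_d f m * g (m + d) * h (m + d *+ 2).

Definition dot (K : pzRingType) n (a x : 'rV[K]_n) : K :=
  \sum_i a 0 i * x 0 i.

Section Dot.
Variables (K : fieldType) (n : nat).
Implicit Types a b x y : 'rV[K]_n.

Lemma dotDl a b x : dot (a + b) x = dot a x + dot b x.
Proof. by rewrite -big_split; apply: eq_bigr => i _; rewrite mxE mulrDl. Qed.

Lemma dotDr a x y : dot a (x + y) = dot a x + dot a y.
Proof. by rewrite -big_split; apply: eq_bigr => i _; rewrite mxE mulrDr. Qed.

Lemma dotZr a k x : dot a (k *: x) = k * dot a x.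
Proof. by rewrite mulr_sumr; apply: eq_bigr => i _; rewrite mxE mulrCA. Qed.

Lemma dotC a x : dot a x = dot x a.
Proof. by apply: eq_bigr => i _; rewrite mulrC. Qed.

Lemma dot0r a : dot a 0 = 0.
Proof. by apply: big1 => i _; rewrite mxE mulr0. Qed.

Lemma dotNr a x : dot a (- x) = - dot a x.
Proof. by rewrite -scaleN1r dotZr mulN1r. Qed.

Lemma dotNl a x : dot (- a) x = - dot a x.
Proof. by rewrite dotC dotNr dotC. Qed.

Lemma dotMn a x k : dot a (x *+ k) = dot a x *+ k.
Proof. by elim: k => [|k IH]; rewrite ?mulr0n ?dot0r // !mulrS dotDr IH. Qed.

Lemma dot_eq1 x : x != 0 -> exists b, dot b x = 1.
Proof.
move=> /rV0Pn [i xi]; exists (\row_j ((j == i)%:R / x 0 i)).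
rewrite /dot (bigD1 i) //= big1 => [|j /negPf ne]; rewrite mxE ?eqxx ?ne ?mul0r //.
by rewrite addr0 mul1r mulVf.
Qed.

End Dot.

(** With the first and middle terms as parameters the third is [y *+ 2 - x], so nothing has to be
    divided by 2. *)
Lemma ap3_mid (K : pzRingType) (U : finZmodType) (f g h : U -> K) :
  ap3 f g h = \sum_x \sum_y f x * g y * h (y *+ 2 - x).
Proof.
apply: eq_bigr => x _; rewrite [RHS](reindex_inj (addrI x)) /=.
apply: eq_bigr => d _; congr (_ * h _).
by rewrite mulrnDl [X in X + _ - _]mulr2n addrAC addrK.
Qed.

Section Characters.
Variables (C : numClosedFieldType) (p : nat) (p_pr : prime p).

Lemma nontrivial_unity_root : exists z : C, z ^+ p = 1 /\ z != 1.
Proof.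
have p_gt1 := prime_gt1 p_pr.
pose P : {poly C} := \poly_(i < p) 1.
have sP : size P = p by apply: size_poly_eq; rewrite oner_neq0.
have /closed_rootP [z /rootP zP] : size P != 1%N.
  by rewrite sP neq_ltn p_gt1 orbT.
have zE : \sum_(i < p) z ^+ i = 0.
  by rewrite -[RHS]zP horner_poly; apply: eq_bigr => i _; rewrite mul1r.
exists z; split; first by apply/eqP; rewrite -subr_eq0 subrX1 zE mulr0.
apply/eqP => z1; move/eqP: zE; rewrite z1.
under eq_bigr do rewrite expr1n.
by rewrite sumr_const card_ord pnatr_eq0 gtn_eqF ?prime_gt0.
Qed.

Variables (z : C) (zp : z ^+ p = 1) (z1 : z != 1).

Definition chi (t : 'F_p) : C := z ^+ t.

Lemma chiD s t : chi (s + t) = chi s * chi t.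
Proof.
rewrite /chi -exprD -(expr_mod (s + t) zp); congr (_ ^+ _).
exact: (congr1 (modn (s + t)) (Fp_cast p_pr)).
Qed.

Lemma chi0 : chi 0 = 1. Proof. by []. Qed.

Lemma chi1 : chi 1 = z.
Proof. by []. Qed.

Lemma normr_chi t : `|chi t| = 1.
Proof.
rewrite normrX; suff -> : `|z| = 1 by rewrite expr1n.
apply/eqP; rewrite -(@pexpr_eq1 _ `|z| p) ?normr_ge0 ?prime_gt0 //.
by rewrite -normrX zp normr1.
Qed.

Lemma conj_chi t : (chi t)^* = chi (- t).
Proof.
have chi_n0 : chi t != 0 by rewrite -normr_eq0 normr_chi oner_neq0.
apply: (mulfI chi_n0); rewrite -chiD subrr chi0.
by rewrite -normCK normr_chi expr1n.
Qed.

Variable n : nat.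
Local Notation G := 'rV['F_p]_n.

(** For [x != 0], translating [a] by some [b] with [dot b x = 1] multiplies the sum by [z], which
    differs from 1. *)
Lemma sum_chi_dot (x : G) :
  \sum_(a : G) chi (dot a x) = if x == 0 then (p ^ n)%:R else 0.
Proof.
have [->|x_n0] := eqVneq x 0.
  under eq_bigr do rewrite dot0r chi0.
  by rewrite sumr_const card_mx mul1n card_Fp.
have [b bx] := dot_eq1 x_n0; apply/eqP.
set s := \sum_a _; have : (z - 1) * s == 0.
  rewrite mulrBl mul1r subr_eq0 /s {2}(reindex_inj (addrI b)) mulr_sumr /=.
  by apply/eqP/eq_bigr => a _; rewrite dotDl chiD bx chi1.
by rewrite mulf_eq0 subr_eq0 (negPf z1).
Qed.

Definition fourier (f : G -> C) (a : G) : C := \sum_x f x * chi (dot a x).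

Lemma parseval f : \sum_a `|fourier f a| ^+ 2 = (p ^ n)%:R * \sum_x `|f x| ^+ 2.
Proof.
transitivity (\sum_a \sum_x \sum_y f x * (f y)^* * chi (dot a (x - y))).
  apply: eq_bigr => a _; rewrite normCK rmorph_sum mulr_suml.
  apply: eq_bigr => x _; rewrite mulr_sumr; apply: eq_bigr => y _.
  by rewrite rmorphM /= conj_chi mulrACA -chiD dotDr dotNr.
rewrite exchange_big mulr_sumr; apply: eq_bigr => x _ /=.
rewrite exchange_big (bigD1 x) //= -mulr_sumr sum_chi_dot subrr eqxx -normCK mulrC.
rewrite big1 ?addr0 // => y ne; rewrite -mulr_sumr sum_chi_dot subr_eq0.
by rewrite eq_sym (negPf ne) mulr0.
Qed.

(** Orthogonality of characters detects the relation [x - 2y + w = 0]; its coefficients 1, -2, 1 are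
    the multiples of [a] at which the three transforms are taken. *)
Lemma ap3_fourier f g h : (p ^ n)%:R * ap3 f g h =
  \sum_a fourier f a * fourier g (- (a *+ 2)) * fourier h a.
Proof.
rewrite ap3_mid; transitivity (\sum_(a : G) \sum_x \sum_y \sum_w
    f x * g y * h w * chi (dot a (w - (y *+ 2 - x)))); last first.
  apply: eq_bigr => a _; rewrite -mulrA [in RHS]mulr_suml; apply: eq_bigr => x _.
  rewrite [in RHS]mulr_suml mulr_sumr; apply: eq_bigr => y _.
  rewrite !mulr_sumr; apply: eq_bigr => w _.
  rewrite opprB addrA addrAC !dotDr dotNr dotMn.
  have -> : dot (- (a *+ 2)) y = - (dot a y *+ 2) by rewrite dotNl dotC dotMn dotC.
  by rewrite !chiD; ring.
rewrite [RHS]exchange_big mulr_sumr; apply: eq_bigr => x _ /=.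
rewrite [RHS]exchange_big mulr_sumr; apply: eq_bigr => y _ /=.
rewrite [RHS]exchange_big (bigD1 (y *+ 2 - x)) //= -mulr_sumr sum_chi_dot subrr eqxx mulrC.
rewrite big1 ?addr0 // => w ne; rewrite -mulr_sumr sum_chi_dot subr_eq0.
by rewrite (negPf ne) mulr0.
Qed.

End Characters.

Lemma Fp_two_neq0 p : prime p -> odd p -> (2 : 'F_p) != 0.
Proof.
move=> p_pr p_odd; rewrite -(dvdn_pcharf (pchar_Fp p_pr)).
by rewrite dvdn_prime2 //; apply: contraTneq p_odd => ->.
Qed.

Section FourierBound.
Variables (C : numClosedFieldType) (p : nat) (p_pr : prime p) (p_odd : odd p).
Variables (z : C) (zp : z ^+ p = 1) (z1 : z != 1) (n : nat).
Local Notation G := 'rV['F_p]_n.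
Implicit Types (f g h : G -> C) (M : C).

Lemma mulr2n_inj : injective (fun x : G => x *+ 2).
Proof.
move=> x y; rewrite -!scaler_nat => /eqP; rewrite -subr_eq0 -scalerBr scaler_eq0.
by rewrite (negPf (Fp_two_neq0 p_pr p_odd)) subr_eq0 => /eqP.
Qed.

Lemma sum_normM_le (I : finType) (M : C) (u v w : I -> C) :
  (forall i, `|u i| <= M) ->
  `|\sum_i u i * v i * w i| <= M * ((\sum_i `|v i| ^+ 2 + \sum_i `|w i| ^+ 2) / 2).
Proof.
move=> uM; apply: le_trans (ler_norm_sum _ _ _) _.
rewrite -big_split mulr_suml mulr_sumr /=; apply: ler_sum => i _.
rewrite -mulrA !normrM ler_pM ?mulr_ge0 // ler_pdivlMr // mulr_natr.
have := real_exprn_even_ge0 (realB (normr_real (v i)) (normr_real (w i))) (erefl : ~~ odd 2).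
by rewrite sqrrB addrAC subr_ge0.
Qed.

(** One factor is taken out in sup norm and the other two go through Parseval, whose [p ^ n] cancels
    the one in [ap3_fourier]. *)
Lemma ap3_le_mid f g h M : (forall a, `|fourier z g a| <= M) ->
  `|ap3 f g h| <= M * ((\sum_(x : G) `|f x| ^+ 2 + \sum_x `|h x| ^+ 2) / 2).
Proof.
move=> gM; have pn_gt0 : 0 < (p ^ n)%:R :> C by rewrite ltr0n expn_gt0 prime_gt0.
rewrite -(ler_pM2l pn_gt0) -[X in X * `|_|](ger0_norm (ltW pn_gt0)) -normrM.
rewrite (ap3_fourier p_pr zp z1).
under eq_bigr => a _ do rewrite [_ * fourier z g _]mulrC.
apply: le_trans (sum_normM_le _ _ (fun a => gM (- (a *+ 2)))) _.
by rewrite !(parseval p_pr zp z1) -mulrDr -mulrA mulrCA.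
Qed.

Lemma ap3_le_left f g h M : (forall a, `|fourier z f a| <= M) ->
  `|ap3 f g h| <= M * ((\sum_(x : G) `|g x| ^+ 2 + \sum_x `|h x| ^+ 2) / 2).
Proof.
move=> fM; have pn_gt0 : 0 < (p ^ n)%:R :> C by rewrite ltr0n expn_gt0 prime_gt0.
rewrite -(ler_pM2l pn_gt0) -[X in X * `|_|](ger0_norm (ltW pn_gt0)) -normrM.
rewrite (ap3_fourier p_pr zp z1).
apply: le_trans (sum_normM_le _ _ fM) _.
(* Since p is odd, multiplication by -2 permutes the frequencies. *)
have -> : \sum_(a : G) `|fourier z g (- (a *+ 2))| ^+ 2
  = \sum_a `|fourier z g a| ^+ 2.
  by rewrite [RHS](reindex_inj (inj_comp oppr_inj mulr2n_inj)).
by rewrite !(parseval p_pr zp z1) -mulrDr -mulrA mulrCA.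
Qed.

Lemma ap3_rev (K : comPzRingType) (f g h : G -> K) : ap3 f g h = ap3 h g f.
Proof.
rewrite !ap3_mid exchange_big [RHS]exchange_big /=; apply: eq_bigr => y _.
rewrite (reindex_inj (inj_comp (addrI (y *+ 2)) oppr_inj)) /=.
apply: eq_bigr => x _; rewrite subKr; ring.
Qed.

Lemma ap3_le_right f g h M : (forall a, `|fourier z h a| <= M) ->
  `|ap3 f g h| <= M * ((\sum_(x : G) `|f x| ^+ 2 + \sum_x `|g x| ^+ 2) / 2).
Proof. by move=> hM; rewrite ap3_rev [X in X / 2]addrC ap3_le_left. Qed.

End FourierBound.

Section RealFourier.
Variables (R : rcfType) (p : nat) (p_pr : prime p) (p_odd : odd p).
Variables (z : R[i]) (zp : z ^+ p = 1) (z1 : z != 1) (n : nat).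
Local Notation G := 'rV['F_p]_n.
Implicit Types (f g h : G -> R) (a : G).

Definition rfourier f a := fourier z (fun x => (f x)%:C%C) a.

(** The modulus as an element of [R], whose order is total, unlike that of [R[i]]. *)
Definition fsize f a : R := ComplexField.Normc.normc (rfourier f a).

Lemma fsizeE f a : (fsize f a)%:C%C = `|rfourier f a|.
Proof. by []. Qed.

Lemma ap3_real f g h : (ap3 f g h)%:C%C =
  ap3 (fun x => (f x)%:C%C) (fun x => (g x)%:C%C) (fun x => (h x)%:C%C) :> R[i].
Proof.
rewrite /ap3 rmorph_sum; apply: eq_bigr => x _.
by rewrite rmorph_sum; apply: eq_bigr => y _; rewrite !rmorphM.
Qed.

Lemma normr_real_complex (x : R) : `|x%:C%C : R[i]| = `|x|%:C%C.
Proof. by rewrite normc_def /= expr0n addr0 sqrtr_sqr. Qed.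

Lemma sum_sqr_real f :
  \sum_x `|(f x)%:C%C : R[i]| ^+ 2 = (\sum_x f x ^+ 2)%:C%C.
Proof.
rewrite rmorph_sum; apply: eq_bigr => x _.
by rewrite normr_real_complex -rmorphXn /= real_normK // num_real.
Qed.

Lemma fsize_parseval f : \sum_a fsize f a ^+ 2 = (p ^ n)%:R * \sum_x f x ^+ 2.
Proof.
apply: (@complexI R); rewrite rmorph_sum rmorphM rmorph_nat /= -sum_sqr_real.
by rewrite -(parseval p_pr zp z1); apply: eq_bigr => a _; rewrite rmorphXn.
Qed.

(** Generalized von Neumann inequality: uniformity in any one of the three slots makes the count
    small. *)
Lemma ap3_bound f g h M N :
  (forall a, fsize f a <= M) \/ (forall a, fsize g a <= M)
    \/ (forall a, fsize h a <= M) ->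
  \sum_x f x ^+ 2 <= N -> \sum_x g x ^+ 2 <= N -> \sum_x h x ^+ 2 <= N ->
  `|ap3 f g h| <= M * N.
Proof.
have half u v : 0 <= M -> \sum_(x : G) u x ^+ 2 <= N -> \sum_(x : G) v x ^+ 2 <= N ->
    M * ((\sum_(x : G) u x ^+ 2 + \sum_(x : G) v x ^+ 2) / 2) <= M * N.
  by move=> M_ge0 uN vN; rewrite ler_wpM2l // ler_pdivrMr // mulr_natr mulr2n lerD.
have ge0 u : (forall a, fsize u a <= M) -> 0 <= M.
  by move=> uM; apply: le_trans (uM 0); rewrite -ler0c fsizeE.
pose toC u (x : G) := (u x)%:C%C : R[i].
have toC_le u : (forall a, fsize u a <= M) -> forall a, `|rfourier u a| <= M%:C%C.
  by move=> uM a; rewrite -fsizeE lecR.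
move=> le_M fN gN hN; rewrite -lecR -normr_real_complex ap3_real.
case: le_M => [|[]] uM; have M_ge0 := ge0 _ uM.
- have := ap3_le_left p_pr p_odd zp z1 (toC g) (toC h) (toC_le _ uM).
  rewrite !sum_sqr_real => /le_trans; apply.
  by rewrite -rmorphD -(rmorph_nat (real_complex R) 2) -fmorph_div -rmorphM lecR half.
- have := ap3_le_mid p_pr zp z1 (toC f) (toC h) (toC_le _ uM).
  rewrite !sum_sqr_real => /le_trans; apply.
  by rewrite -rmorphD -(rmorph_nat (real_complex R) 2) -fmorph_div -rmorphM lecR half.
- have := ap3_le_right p_pr p_odd zp z1 (toC f) (toC g) (toC_le _ uM).
  rewrite !sum_sqr_real => /le_trans; apply.
  by rewrite -rmorphD -(rmorph_nat (real_complex R) 2) -fmorph_div -rmorphM lecR half.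
Qed.

End RealFourier.

(** * Regularity *)

Section Averages.
Variables (R : rcfType) (p : nat) (p_pr : prime p) (p_odd : odd p) (n : nat).
Local Notation G := 'rV['F_p]_n.
Implicit Types (f g h : G -> R) (a x : G) (W : {vspace G}).

(** [W'] is the kernel on [W] of the map whose coordinates are the [size s] dot products;
    rank-nullity bounds the loss of dimension. *)
Lemma perp_vspace W (s : seq G) : exists W' : {vspace G},
  [/\ (W' <= W)%VS, (\dim W <= \dim W' + size s)%N &
      forall w, (w \in W') = (w \in W) && all (fun a => dot a w == 0) s].
Proof.
pose A := \matrix_(i < n, j < size s) (s`_j) 0 i.
pose F : 'Hom(G, 'rV['F_p]_(size s)) := linfun (mulmxr A).
have FE w j : F w 0 j = dot s`_j w.
  by rewrite lfunE mxE; apply: eq_bigr => i _; rewrite mxE mulrC.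
exists (W :&: lker F)%VS; split; first exact: capvSl.
  rewrite -(limg_ker_dim F W) leq_add2l (leq_trans (dimvS (subvf _))) //.
  by rewrite dimvf dim_matrix mul1r.
move=> w; rewrite memv_cap memv_ker; congr (_ && _).
apply/eqP/allP => [F0 a /(nthP 0) [j js <-]|s0].
  by rewrite -(FE w (Ordinal js)) F0 mxE.
by apply/rowP => j; rewrite FE mxE (eqP (s0 _ _)) // mem_nth.
Qed.

Lemma card_vspace_gt0 W : 0 < #|W|%:R :> R.
Proof. by rewrite ltr0n card_vspace expn_gt0 card_Fp // prime_gt0. Qed.

Definition avg W f x : R := #|W|%:R^-1 * \sum_(w in W) f (x + w).

Lemma avg_inv W f x w : w \in W -> avg W f (x + w) = avg W f x.
Proof.
move=> wW; rewrite /avg [in RHS](reindex_inj (addrI w)) /=; congr (_ * _).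
by apply: eq_big => v; rewrite ?rpredDl ?addrA.
Qed.

Lemma sum_avg W f : \sum_x avg W f x = \sum_x f x.
Proof.
rewrite -mulr_sumr exchange_big /=.
have shift w : \sum_x f (x + w) = \sum_x f x by rewrite [RHS](reindex_inj (addIr w)).
under eq_bigr => w _ do rewrite shift.
by rewrite sumr_const -[X in _ * X]mulr_natl mulKf // gt_eqF ?card_vspace_gt0.
Qed.

Lemma avg_itv W f x : (forall y, 0 <= f y <= 1) -> 0 <= avg W f x <= 1.
Proof.
move=> f01; have W_gt0 := card_vspace_gt0 W; rewrite /avg; apply/andP; split.
  by rewrite mulr_ge0 ?invr_ge0 ?ler0n ?sumr_ge0 // => w _; case/andP: (f01 (x + w)).
rewrite mulrC ler_pdivrMr // mul1r -sumr_const ler_sum // => w _.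
by case/andP: (f01 (x + w)).
Qed.

Variables (z : R[i]) (zp : z ^+ p = 1) (z1 : z != 1).

(** Averaging is convolution with the uniform measure on [W], so it multiplies each coefficient by a
    transform of that measure. *)
Lemma rfourier_sub_avg W f a : rfourier z (fun x => f x - avg W f x) a =
  rfourier z f a * (1 - #|W|%:R^-1 * \sum_(w in W) chi z (- dot a w)).
Proof.
transitivity (rfourier z f a - rfourier z (avg W f) a).
  rewrite -sumrB; apply: eq_bigr => x _.
  by rewrite rmorphB mulrBl.
rewrite mulrBr mulr1; congr (_ - _).
rewrite mulrCA mulr_sumr /rfourier /fourier.
transitivity (\sum_x #|W|%:R^-1 * (\sum_(w in W) (f (x + w))%:C%C * chi z (dot a x))).
  apply: eq_bigr => x _; rewrite rmorphM fmorphV rmorph_nat rmorph_sum -mulrA.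
  by rewrite mulr_suml.
rewrite -mulr_sumr exchange_big /=; congr (_ * _); apply: eq_bigr => w _.
rewrite (reindex_inj (addIr (- w))) mulr_suml /=; apply: eq_bigr => x _.
by rewrite subrK dotDr dotNr (chiD p_pr zp) mulrA.
Qed.

Lemma fsize_sub_avg_perp W f a :
  (forall w, w \in W -> dot a w = 0) -> fsize z (fun x => f x - avg W f x) a = 0.
Proof.
move=> aW; rewrite /fsize rfourier_sub_avg.
under eq_bigr => w wW do rewrite aW // oppr0 chi0.
rewrite sumr_const mulVf ?subrr ?mulr0 ?ComplexField.Normc.normc0 //.
by rewrite pnatr_eq0 -lt0n -(ltr0n R) card_vspace_gt0.
Qed.

Lemma fsize_sub_avg W f a : fsize z (fun x => f x - avg W f x) a <= 2 * fsize z f a.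
Proof.
rewrite -lecR rmorphM !fsizeE rfourier_sub_avg normrM mulrC ler_wpM2r //.
have W_gt0 : 0 < #|W|%:R :> R[i] by rewrite ltr0n -(ltr0n R) card_vspace_gt0.
apply: le_trans (ler_normB _ _) _.
rewrite normr1 rmorph_nat mulr2n lerD // normrM gtr0_norm ?invr_gt0 // mulrC.
rewrite ler_pdivrMr // mul1r -sumr_const (le_trans (ler_norm_sum _ _ _)) //.
by apply: ler_sum => w _; rewrite (normr_chi p_pr zp).
Qed.

(** [W] is the annihilator of the frequencies whose coefficient exceeds [th * p ^ n]. The
    coefficients of [f - avg W f] vanish on those and are at most [2 * th * p ^ n] elsewhere.
    Replacing [f] by its average one slot at a time costs this bound three times, hence the 6. *)
Lemma regularity_of_root (th : R) f : 0 < th -> (forall x, 0 <= f x <= 1) ->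
  exists W, n%:R - th ^- 2 <= (\dim W)%:R /\
    ap3 (avg W f) (avg W f) (avg W f) <= ap3 f f f + 6 * th * (p ^ n)%:R ^+ 2.
Proof.
move=> th_gt0 f01; set P : R := (p ^ n)%:R.
have P_gt0 : 0 < P by rewrite ltr0n expn_gt0 prime_gt0.
have sq_le g : (forall x, -1 <= g x <= 1) -> \sum_x g x ^+ 2 <= P.
  move=> g1; have -> : P = \sum_(x : G) 1.
    by rewrite sumr_const card_mx card_Fp ?mul1n.
  by apply: ler_sum => x _; have := g1 x; nra.
pose A := [pred a | th * P < fsize z f a].
(* Parseval gives [|A| * (th * P)^2 <= P * \sum_x f x ^+ 2 <= P^2]. *)
have A_le : (size (enum A))%:R <= th ^- 2.
  rewrite -[leRHS]mul1r ler_pdivlMr ?exprn_gt0 //.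
  rewrite -(ler_pM2r (exprn_gt0 2 P_gt0)) -mulrA -exprMn mul1r.
  apply: (@le_trans _ _ (P * \sum_x f x ^+ 2)); last first.
    by rewrite [leRHS]expr2 ler_wpM2l ?(ltW P_gt0) ?sq_le // => x; have := f01 x; lra.
  rewrite -(fsize_parseval p_pr zp z1) (bigID (mem A)) /=.
  rewrite -[leLHS]addr0 lerD ?sumr_ge0 // => [|a _]; last exact: sqr_ge0.
  rewrite -cardE mulr_natl -sumr_const; apply: ler_sum => a aA.
  have thP := mulr_gt0 th_gt0 P_gt0.
  by rewrite ler_sqr ?nnegrE ?(ltW aA) ?(ltW thP) ?(ltW (lt_trans thP aA)).
have [W [_ dimW perpW]] := perp_vspace fullv (enum A).
exists W; split.
  rewrite lerBlDr (le_trans _ (lerD (lexx _) A_le)) // -natrD ler_nat.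
  by rewrite (leq_trans _ dimW) // dimvf dim_matrix mul1r.
pose D x := f x - avg W f x.
have D_le a : fsize z D a <= 2 * th * P.
  have [aA|] := boolP (a \in A).
    rewrite fsize_sub_avg_perp ?mulr_ge0 ?ltW // => w; rewrite perpW.
    by case/andP => _ /allP /(_ a); rewrite mem_enum => /(_ aA) /eqP.
  rewrite inE -leNgt => a_le; apply: le_trans (fsize_sub_avg _ _ _) _.
  by rewrite -mulrA ler_pM2l.
have f2 := sq_le f (fun x => ltac:(have := f01 x; lra)).
have F2 := sq_le (avg W f) (fun x => ltac:(have := avg_itv W x f01; lra)).
have D2 := sq_le D (fun x => ltac:(rewrite /D; have := f01 x; have := avg_itv W x f01; lra)).
have T1 := ap3_bound p_pr p_odd zp z1 (or_introl D_le) D2 f2 f2.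
have T2 := ap3_bound p_pr p_odd zp z1 (or_intror (or_introl D_le)) F2 D2 f2.
have T3 := ap3_bound p_pr p_odd zp z1 (or_intror (or_intror D_le)) F2 F2 D2.
have TE : ap3 f f f - ap3 (avg W f) (avg W f) (avg W f) =
    ap3 D f f + ap3 (avg W f) D f + ap3 (avg W f) (avg W f) D.
  rewrite /ap3 -!(sumrB, big_split) /=; apply: eq_bigr => x _.
  by rewrite -!(sumrB, big_split) /=; apply: eq_bigr => d _; rewrite /D; ring.
move: T1 T2 T3; rewrite !ler_norml => /andP[T1 _] /andP[T2 _] /andP[T3 _]; lra.
Qed.

End Averages.

(** * Varnavides' theorem by density increment *)

Section DensityIncrement.
Variables (R : rcfType) (p : nat) (p_pr : prime p) (p_odd : odd p) (n : nat).
Local Notation G := 'rV['F_p]_n.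
Implicit Types (f g h : G -> R) (a x : G) (W : {vspace G}).

Lemma sum_vspace_shift W f x : x \in W ->
  \sum_(d in W) f (x + d) = \sum_(d in W) f d.
Proof.
move=> xW; rewrite [RHS](reindex_inj (addrI x)) /=.
by apply: eq_bigl => d; rewrite rpredDl.
Qed.

(** Any two of the terms m, m+d, m+2d range independently over [W], as p is odd. So in the expansion
    every product with just one or two factors [k] sums to 0. *)
Lemma ap3_vspace_eq W (k : G -> R) (mu : R) : \sum_(w in W) k w = 0 ->
  \sum_(m in W) \sum_(d in W) (mu + k m) * (mu + k (m + d)) * (mu + k (m + d *+ 2)) =
  mu ^+ 3 * #|W|%:R ^+ 2 + \sum_(m in W) \sum_(d in W) k m * k (m + d) * k (m + d *+ 2).
Proof.
move=> k0.
have sum1 x : x \in W -> \sum_(d in W) k (x + d) = 0.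
  by move=> xW; rewrite sum_vspace_shift.
have sum2 x : x \in W -> \sum_(d in W) k (x + d *+ 2) = 0.
  move=> xW; rewrite -[RHS]k0 -(sum_vspace_shift k xW).
  rewrite [RHS](reindex_inj (@mulr2n_inj _ p_pr p_odd n)) /=.
  apply: eq_bigl => d; rewrite -scaler_nat rpredZeq.
  by rewrite (negPf (Fp_two_neq0 p_pr p_odd)).
have sum12 : \sum_(m in W) \sum_(d in W) k (m + d) * k (m + d *+ 2) = 0.
  transitivity (\sum_(d in W) \sum_(m in W) k m * k (m + d)).
    rewrite exchange_big; apply: eq_bigr => d dW.
    rewrite -(sum_vspace_shift (fun y => k y * k (y + d)) dW).
    by apply: eq_bigr => m _; rewrite mulr2n addrA [d + m]addrC.
  by rewrite exchange_big big1 // => m mW; rewrite -mulr_sumr sum1 ?mulr0.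
transitivity (\sum_(m in W) (mu ^+ 3 * #|W|%:R + mu ^+ 2 * #|W|%:R * k m +
    mu * \sum_(d in W) k (m + d) * k (m + d *+ 2) +
    \sum_(d in W) k m * k (m + d) * k (m + d *+ 2))).
  apply: eq_bigr => m mW.
  transitivity (\sum_(d in W) ((mu ^+ 3 + mu ^+ 2 * k m) +
      (mu ^+ 2 + mu * k m) * k (m + d) + (mu ^+ 2 + mu * k m) * k (m + d *+ 2) +
      mu * (k (m + d) * k (m + d *+ 2)) + k m * k (m + d) * k (m + d *+ 2))).
    by apply: eq_bigr => d _; ring.
  rewrite !big_split -!mulr_sumr /= sum1 // sum2 // !mulr0 !addr0 !sumr_const.
  by ring.
rewrite !big_split -!mulr_sumr /= k0 sum12 !mulr0 !addr0 !sumr_const.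
by ring.
Qed.

Lemma ap3_indic W f : ap3 (fun x => (x \in W)%:R * f x) (fun x => (x \in W)%:R * f x)
    (fun x => (x \in W)%:R * f x) =
  \sum_(m in W) \sum_(d in W) f m * f (m + d) * f (m + d *+ 2).
Proof.
rewrite /ap3 [RHS]big_mkcond; apply: eq_bigr => m _ /=.
have [mW|_] := boolP (m \in W); last by rewrite big1 // => d _; rewrite !mul0r.
rewrite [RHS]big_mkcond; apply: eq_bigr => d _ /=.
have -> : (m + d *+ 2 \in W) = (d \in W).
  rewrite rpredDl // -scaler_nat rpredZeq.
  by rewrite (negPf (Fp_two_neq0 p_pr p_odd)).
by rewrite rpredDl //; case: (d \in W); rewrite /= ?mul1r // !mul0r mulr0.
Qed.

Lemma ap3_shift f x : ap3 (fun y => f (x + y)) (fun y => f (x + y)) (fun y => f (x + y))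
  = ap3 f f f.
Proof.
rewrite /ap3 [RHS](reindex_inj (addrI x)) /=; apply: eq_bigr => m _.
by apply: eq_bigr => d _; rewrite !addrA.
Qed.

Lemma ler_ap3 f g : (forall x, 0 <= f x <= g x) -> ap3 f f f <= ap3 g g g.
Proof.
move=> fg; apply: ler_sum => m _; apply: ler_sum => d _.
have ge0 x : 0 <= f x by case/andP: (fg x).
have le x : f x <= g x by case/andP: (fg x).
by rewrite !ler_pM ?mulr_ge0.
Qed.

Variables (z : R[i]) (zp : z ^+ p = 1) (z1 : z != 1).

Lemma fsize_le_slices f a :
  fsize z f a <= \sum_t `|\sum_(x | dot a x == t) f x|.
Proof.
rewrite -lecR fsizeE; have -> : rfourier z f a =
    \sum_t (\sum_(x | dot a x == t) f x)%:C%C * chi z t.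
  rewrite /rfourier /fourier (partition_big (dot a) predT) //=.
  apply: eq_bigr => t _; rewrite rmorph_sum mulr_suml.
  by apply: eq_bigr => x /eqP ->.
apply: le_trans (ler_norm_sum _ _ _) _; rewrite rmorph_sum; apply: ler_sum => t _.
by rewrite normrM (normr_chi p_pr zp) mulr1 normr_real_complex.
Qed.

(** The absolute slice sums add up to more than [M]. As the slice sums cancel, the positive ones
    account for half of that, and there are only p slices. *)
Lemma exists_large_slice f a (M : R) : \sum_x f x = 0 -> M < fsize z f a ->
  exists t, M / (2 * p%:R) < \sum_(x | dot a x == t) f x.
Proof.
move=> f0 M_lt; apply/existsP; apply: contraLR M_lt.
rewrite negb_exists -leNgt => /forallP small.
have p_gt0 : 0 < p%:R :> R by rewrite ltr0n prime_gt0.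
have slices0 : \sum_t \sum_(x | dot a x == t) f x = 0.
  by rewrite -[RHS]f0 [RHS](partition_big (dot a) predT).
have M_ge0 : 0 <= M / (2 * p%:R).
  rewrite -(pmulr_rge0 _ p_gt0) -slices0.
  have -> : p%:R * (M / (2 * p%:R)) = \sum_(t : 'F_p) (M / (2 * p%:R)).
    by rewrite sumr_const card_Fp // mulr_natl.
  by apply: ler_sum => t _; rewrite leNgt.
apply: le_trans (fsize_le_slices _ _) _.
(* Termwise [|s| <= 2c - s], because [s <= c] and [0 <= c] for [c = M / (2p)]. *)
have -> : M = \sum_(t : 'F_p) (2 * (M / (2 * p%:R))) - \sum_t \sum_(x | dot a x == t) f x.
  rewrite slices0 subr0 sumr_const card_Fp //.
  by rewrite -mulr_natr; field; rewrite gt_eqF.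
rewrite -sumrB; apply: ler_sum => t _; move: (small t) M_ge0; rewrite -leNgt.
move: (M / _) (\sum_(x | dot a x == t) f x) => c s.
by case: (ger0P s); lra.
Qed.

(** Too few progressions force [ap3 g g g] below [- eps^3 / 2 * |W|^2] for the balanced function
    [g], so [g] has a coefficient above [eps^3 / 2 * |W|]. Some slice of that frequency then carries
    excess mass; it meets [W] in a coset of [W'], of codimension at most 1 in [W]. *)
Lemma density_increment_of_root W f (eps mu : R) :
  (forall x, 0 <= f x <= 1) -> 0 < eps -> eps <= mu ->
  \sum_(w in W) f w = mu * #|W|%:R ->
  ap3 f f f < eps ^+ 3 / 2 * #|W|%:R ^+ 2 ->
  exists (W' : {vspace G}) (x : G), #|W|%:R <= p%:R * #|W'|%:R :> R /\
    (mu + eps ^+ 3 / (4 * p%:R)) * #|W'|%:R <= \sum_(w in W') f (x + w).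
Proof.
move=> f01 eps_gt0 eps_mu sumf small.
have W_gt0 := card_vspace_gt0 R p_pr W.
have p_gt0 : 0 < p%:R :> R by rewrite ltr0n prime_gt0.
pose k x := f x - mu; pose g x := (x \in W)%:R * k x.
have sumk : \sum_(w in W) k w = 0.
  by rewrite sumrB sumf sumr_const mulr_natr subrr.
have sumg : \sum_x g x = 0.
  rewrite -[RHS]sumk [RHS]big_mkcond; apply: eq_bigr => x _.
  by rewrite /g; case: (x \in W); rewrite ?mul1r ?mul0r.
have mu_le1 : mu <= 1.
  rewrite -(ler_pM2r W_gt0) mul1r -sumf -sumr_const ler_sum // => x _.
  by case/andP: (f01 x).
have g2 : \sum_x g x ^+ 2 <= #|W|%:R.
  rewrite -sumr_const [leRHS]big_mkcond; apply: ler_sum => x _.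
  rewrite /g /k; case: (x \in W); rewrite ?mul1r ?mul0r ?expr0n //=.
  have := f01 x; nra.
have gE : ap3 g g g <= ap3 f f f - mu ^+ 3 * #|W|%:R ^+ 2.
  rewrite ap3_indic lerBrDl -(ap3_vspace_eq _ sumk).
  apply: (@le_trans _ _ (ap3 (fun x => (x \in W)%:R * f x)
    (fun x => (x \in W)%:R * f x) (fun x => (x \in W)%:R * f x))).
    rewrite ap3_indic; apply: ler_sum => m _; apply: ler_sum => d _.
    by rewrite /k ![mu + _]addrC !subrK.
  apply: ler_ap3 => x; have := f01 x.
  by case: (x \in W); rewrite ?mul1r ?mul0r //; case/andP=> -> _; rewrite lexx.
set M := eps ^+ 3 / 2 * #|W|%:R.
have [a aM] : exists a, M < fsize z g a.
  apply: contrapT => noa; have gM a : fsize z g a <= M.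
    by rewrite leNgt; apply/negP => ?; apply: noa; exists a.
  have := ap3_bound p_pr p_odd zp z1 (or_introl gM) g2 g2 g2.
  rewrite ler_norml => /andP[+ _]; apply/negP; rewrite -ltNge.
  apply: le_lt_trans gE _.
  have : eps ^+ 3 <= mu ^+ 3 by rewrite lerXn2r ?nnegrE; lra.
  rewrite -(ler_pM2r (exprn_gt0 2 W_gt0)) /M; lra.
have [t tM] := exists_large_slice sumg aM.
(* If the slice missed [W], the sum of [g] over it would be 0 and not positive. *)
have [x xW /eqP ax] : exists2 x, x \in W & dot a x == t.
  apply: contrapT => nox; move: tM; rewrite big1 ?ltNge => [|x ax].
    by rewrite ltW // divr_gt0 ?mulr_gt0 ?invr_gt0 ?exprn_gt0.
  rewrite /g; case: (boolP (x \in W)) => xW; last by rewrite mul0r.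
  by case: nox; exists x.
have [W' [W'W dimW' inW']] := perp_vspace W [:: a].
have W'_le : #|W'|%:R <= #|W|%:R :> R.
  by rewrite ler_nat !card_vspace leq_pexp2l ?dimvS // card_Fp ?prime_gt0.
exists W', x; split.
  by rewrite -natrM ler_nat !card_vspace card_Fp // -expnS leq_pexp2l ?prime_gt0 // (leq_trans dimW') // addn1.
have -> : \sum_(w in W') f (x + w) = mu * #|W'|%:R + \sum_(y | dot a y == t) g y.
  rewrite mulr_natr -sumr_const.
  have -> : \sum_(y | dot a y == t) g y = \sum_(w in W') k (x + w).
    rewrite [LHS](reindex_inj (addrI x)) [RHS]big_mkcond [LHS]big_mkcond /=.
    apply: eq_bigr => w _; rewrite /g dotDr ax -[X in _ == X]addr0 (inj_eq (addrI _)).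
    rewrite inW' /= andbT rpredDl //.
    by case: (w \in W); case: (dot a w == 0); rewrite ?mul1r ?mul0r.
  by rewrite -big_split; apply: eq_bigr => w _; rewrite /= [RHS]addrC subrK.
rewrite mulrDl lerD2l (le_trans _ (ltW tM)) // /M.
have -> : eps ^+ 3 / 2 * #|W|%:R / (2 * p%:R) = eps ^+ 3 / (4 * p%:R) * #|W|%:R.
  by field; rewrite gt_eqF.
by rewrite ler_wpM2l // ltW // divr_gt0 ?mulr_gt0 ?exprn_gt0.
Qed.

End DensityIncrement.

Section Varnavides.
Variables (R : realType) (p : nat) (p_pr : prime p) (p_odd : odd p).

(* Each step of the induction passes to a coset of W' inside W and raises the
   density by eps^3 / 4p, which can happen fewer than k times. *)
Lemma ap3_ge_of_density n k (eps mu : R) (W : {vspace 'rV['F_p]_n}) f :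
  (forall x, 0 <= f x <= 1) -> 0 < eps -> eps <= mu ->
  \sum_(w in W) f w = mu * #|W|%:R ->
  1 - mu < k%:R * (eps ^+ 3 / (4 * p%:R)) ->
  eps ^+ 3 / 2 * (p%:R ^+ k) ^- 2 * #|W|%:R ^+ 2 <= ap3 f f f.
Proof.
have [z [zp z1]] := nontrivial_unity_root R[i] p_pr.
have p_ge1 : 1 <= p%:R :> R by rewrite ler1n prime_gt0.
have p_gt0 : 0 < p%:R :> R by apply: lt_le_trans p_ge1.
move=> f01 eps_gt0; elim: k f f01 mu W => [|k IH] f f01 mu W eps_mu sumf.
  have W_gt0 := card_vspace_gt0 R p_pr W.
  rewrite mul0r subr_lt0 => mu_gt1; exfalso; move: mu_gt1; apply/negP; rewrite -leNgt.
  rewrite -(ler_pM2r W_gt0) mul1r -sumf -sumr_const ler_sum // => x _.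
  by case/andP: (f01 x).
move=> mu_k.
have [big|] := leP (eps ^+ 3 / 2 * #|W|%:R ^+ 2) (ap3 f f f).
  apply: le_trans big; rewrite ler_wpM2r ?sqr_ge0 // ler_piMr //.
    by rewrite ltW // divr_gt0 ?exprn_gt0.
  by rewrite invf_le1 ?exprn_ege1 ?exprn_gt0.
case/(density_increment_of_root p_pr p_odd zp z1 f01 eps_gt0 eps_mu sumf).
move=> W' [x [cW sumf']].
have W'_gt0 := card_vspace_gt0 R p_pr W'.
set eta := eps ^+ 3 / (4 * p%:R) in mu_k sumf'.
have eta_gt0 : 0 < eta by rewrite divr_gt0 ?exprn_gt0 ?mulr_gt0.
pose mu' := (\sum_(w in W') f (x + w)) / #|W'|%:R.
have mu'_ge : mu + eta <= mu' by rewrite ler_pdivlMr.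
have sum_mu' : \sum_(w in W') f (x + w) = mu' * #|W'|%:R by rewrite divfK ?gt_eqF.
have mu'_k : 1 - mu' < k%:R * eta by move: mu_k; rewrite -natr1 mulrDl mul1r; lra.
rewrite -(ap3_shift _ x); apply: le_trans (IH _ (fun y => f01 (x + y)) _ _ _ sum_mu' mu'_k).
  (* Passing to [W'] divides the cardinality by at most p, which costs a factor [p ^ -2] in the
     count at each step. *)
  have -> : eps ^+ 3 / 2 * (p%:R ^+ k.+1) ^- 2 * #|W|%:R ^+ 2 =
      eps ^+ 3 / 2 * (p%:R ^+ k) ^- 2 * (#|W|%:R / p%:R) ^+ 2.
    rewrite [p%:R ^+ k.+1]exprS [(p%:R * _) ^+ 2]exprMn [(p%:R ^+ 2 * _)^-1]invfM expr_div_n.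
    move: (p%:R ^- 2) ((p%:R ^+ k) ^- 2) => u v; ring.
  rewrite ler_wpM2l ?mulr_ge0 ?invr_ge0 ?sqr_ge0 ?exprn_ge0 ?(ltW eps_gt0) //.
  by rewrite ler_sqr ?nnegrE ?divr_ge0 // ler_pdivrMr // mulrC.
by apply: le_trans eps_mu (le_trans _ mu'_ge); rewrite lerDl ltW.
Qed.

(** The induction starts from the whole space. Its length depends only on [eps] and [p], so [delta]
    is uniform in [n]. *)
Lemma varnavides (eps : R) : 0 < eps ->
  exists2 delta : R, 0 < delta & forall n (f : 'rV['F_p]_n -> R),
    (forall x, 0 <= f x <= 1) -> eps * (p ^ n)%:R <= \sum_x f x ->
    delta * (p ^ n)%:R ^+ 2 <= ap3 f f f.
Proof.
move=> eps_gt0; have p_gt0 : 0 < p%:R :> R by rewrite ltr0n prime_gt0.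
set eta := eps ^+ 3 / (4 * p%:R).
have eta_gt0 : 0 < eta by rewrite divr_gt0 ?exprn_gt0 ?mulr_gt0.
(* After [k] increments of [eta] the density would exceed 1. *)
pose k := Num.Def.archi_bound eta^-1.
have k_eta : 1 < k%:R * eta.
  rewrite -ltr_pdivrMr // mul1r; apply: archi_boundP; rewrite invr_ge0 ltW //.
exists (eps ^+ 3 / 2 * (p%:R ^+ k) ^- 2).
  by rewrite mulr_gt0 ?divr_gt0 ?invr_gt0 ?exprn_gt0.
move=> n f f01 sumf; have P_gt0 : 0 < (p ^ n)%:R :> R by rewrite ltr0n expn_gt0 prime_gt0.
have cardE : #|(fullv : {vspace 'rV['F_p]_n})| = (p ^ n)%N.
  by rewrite card_vspacef card_mx card_Fp // mul1n.
rewrite -[in leLHS]cardE; apply: (@ap3_ge_of_density _ _ _ ((\sum_x f x) / (p ^ n)%:R)) => //.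
- by rewrite ler_pdivlMr.
- rewrite cardE divfK ?gt_eqF //; apply: eq_bigl => x; exact: memvf.
- apply: le_lt_trans k_eta; rewrite lerBlDr lerDl divr_ge0 ?(ltW P_gt0) ?sumr_ge0 // => x _.
  by case/andP: (f01 x).
Qed.

Lemma regularity n (th : R) (f : 'rV['F_p]_n -> R) :
  0 < th -> (forall x, 0 <= f x <= 1) ->
  exists W, n%:R - th ^- 2 <= (\dim W)%:R /\
    ap3 (avg W f) (avg W f) (avg W f) <= ap3 f f f + 6 * th * (p ^ n)%:R ^+ 2.
Proof.
have [z [zp z1]] := nontrivial_unity_root R[i] p_pr.
exact: (regularity_of_root p_pr p_odd zp z1).
Qed.

End Varnavides.

(** * Rounding functions to sets *)

Section Rounding.
Variables (R : realFieldType) (p : nat) (p_pr : prime p) (p_odd : odd p) (n : nat).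
Local Notation G := 'rV['F_p]_n.
Implicit Types (f : G -> R) (x y : G).

(* Only the progressions with nonzero difference: their three terms are
   distinct, so this is multilinear in the values of f. *)
Definition ap3nt f : R := \sum_m \sum_(d | d != 0) f m * f (m + d) * f (m + d *+ 2).

Lemma ap3_split f : ap3 f f f = ap3nt f + \sum_x f x ^+ 3.
Proof.
rewrite -big_split; apply: eq_bigr => m _ /=.
by rewrite (bigD1 0) //= addrC addr0 mul0rn addr0 !exprS expr0 mulr1 mulrA.
Qed.

Definition transfer f x y (t : R) (u : G) : R :=
  f u + t * ((u == x)%:R - (u == y)%:R).

(* In transfer_concave, a_i = f (m + i d) and e_i is the value at m + i d of the
   difference of the point masses at x and y: distinct points give e_i e_j <= 0. *)
Lemma prod3_perturb_le (t a0 a1 a2 e0 e1 e2 : R) :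
  0 <= a0 -> 0 <= a1 -> 0 <= a2 -> e0 * e1 <= 0 -> e0 * e2 <= 0 -> e1 * e2 <= 0 ->
  (a0 + t * e0) * (a1 + t * e1) * (a2 + t * e2) <=
  a0 * a1 * a2 + t * (e0 * a1 * a2 + a0 * e1 * a2 + a0 * a1 * e2).
Proof.
move=> p0 p1 p2 e01 e02 e12.
have e012 : e0 * e1 * e2 = 0.
  (* The square of [e0 * e1 * e2] is the product of three nonpositive numbers, hence is itself
     nonpositive. *)
  apply/eqP; rewrite -sqrf_eq0 eq_le sqr_ge0 andbT.
  have -> : (e0 * e1 * e2) ^+ 2 = (e0 * e1) * ((e0 * e2) * (e1 * e2)) by ring.
  by rewrite mulr_le0_ge0 ?mulr_le0.
have -> : (a0 + t * e0) * (a1 + t * e1) * (a2 + t * e2) =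
  a0 * a1 * a2 + t * (e0 * a1 * a2 + a0 * e1 * a2 + a0 * a1 * e2) +
  t ^+ 2 * (e0 * e1 * a2 + e0 * e2 * a1 + e1 * e2 * a0) + t ^+ 3 * (e0 * e1 * e2) by ring.
rewrite e012 mulr0 addr0 gerDl mulr_ge0_le0 ?sqr_ge0 //.
by have [[q0 q1] q2] := (mulr_le0_ge0 e01 p2, mulr_le0_ge0 e02 p1, mulr_le0_ge0 e12 p0); lra.
Qed.

(** [L] is the derivative at [t = 0]. One [L] serves both signs of [t], so the sign can later be
    chosen to make [t * L <= 0]. *)
Lemma transfer_concave f x y : (forall u, 0 <= f u) -> x != y ->
  exists L, forall t, ap3nt (transfer f x y t) <= ap3nt f + t * L.
Proof.
move=> f0 xy; pose e u : R := (u == x)%:R - (u == y)%:R.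
exists (\sum_m \sum_(d | d != 0) (e m * f (m + d) * f (m + d *+ 2) +
  f m * e (m + d) * f (m + d *+ 2) + f m * f (m + d) * e (m + d *+ 2))) => t.
rewrite mulr_sumr -big_split; apply: ler_sum => m _ /=.
rewrite mulr_sumr -big_split; apply: ler_sum => d d0 /=.
have eM u v : u != v -> e u * e v <= 0.
  rewrite /e; have [->|ux] := eqVneq u x; last first.
    have [->|uy] := eqVneq u y; last by rewrite subrr mul0r.
    rewrite eq_sym => /negPf ->; case: (v == x) => /=; lra.
  rewrite (negPf xy) eq_sym => /negPf ->; case: (v == y) => /=; lra.
have d2 : d *+ 2 != 0 by rewrite -(mul0rn _ 2) (inj_eq (@mulr2n_inj _ p_pr p_odd n)).
have e01 : e m * e (m + d) <= 0.
  by apply: eM; rewrite -[X in X != _]addr0 (inj_eq (addrI m)) eq_sym.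
have e02 : e m * e (m + d *+ 2) <= 0.
  by apply: eM; rewrite -[X in X != _]addr0 (inj_eq (addrI m)) eq_sym.
have e12 : e (m + d) * e (m + d *+ 2) <= 0.
  apply: eM; rewrite (inj_eq (addrI m)) mulr2n.
  by rewrite -[X in X != _]addr0 (inj_eq (addrI d)) eq_sym.
exact: prod3_perturb_le.
Qed.

Definition frac f : {set G} := [set u | 0 < f u < 1].

Lemma exists_rounding_step f x y (L : R) : (forall u, 0 <= f u <= 1) ->
  x \in frac f -> y \in frac f -> x != y ->
  exists t, [/\ t * L <= 0, (forall u, 0 <= transfer f x y t u <= 1) &
    (#|frac (transfer f x y t)| < #|frac f|)%N].
Proof.
move=> f01; rewrite !inE => fx fy xy.
(* The sign of [t] is opposite to that of [L], and [|t|] grows until one of the two values reaches 0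
   or 1. *)
have [t [tL tx ty txy]] : exists t, [/\ t * L <= 0, 0 <= f x + t <= 1, 0 <= f y - t <= 1
    & [|| f x + t == 0, f x + t == 1, f y - t == 0 | f y - t == 1]].
  have [L0|L0] := lerP L 0.
    have [le|lt] := lerP (f y) (1 - f x).
      exists (f y); split; [nra|lra|lra|by rewrite subrr eqxx !orbT].
    exists (1 - f x); split; [nra|lra|lra|by rewrite [_ + (1 - _)]addrC subrK eqxx !orbT].
  have [le|lt] := lerP (f x) (1 - f y).
    exists (- f x); split; [nra|lra|lra|by rewrite subrr eqxx].
  exists (f y - 1); split; [nra|lra|lra|by rewrite opprB [_ + (1 - _)]addrC subrK eqxx !orbT].
have Tx : transfer f x y t x = f x + t by rewrite /transfer eqxx (negPf xy) subr0 mulr1.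
have Ty : transfer f x y t y = f y - t.
  by rewrite /transfer eqxx eq_sym (negPf xy) sub0r mulrN1.
have Tu u : u != x -> u != y -> transfer f x y t u = f u.
  by move=> /negPf ux /negPf uy; rewrite /transfer ux uy subrr mulr0 addr0.
exists t; split=> //.
  move=> u; have [->|ux] := eqVneq u x; first by rewrite Tx.
  by have [->|uy] := eqVneq u y; rewrite ?Ty // Tu.
apply: proper_card; apply/properP; split.
  apply/fintype.subsetP => u; rewrite !inE.
  have [->|ux] := eqVneq u x; first by rewrite fx.
  by have [->|uy] := eqVneq u y; rewrite ?fy // Tu.
case/or4P: txy => /eqP E; [exists x|exists x|exists y|exists y]; rewrite !inE //.
- by rewrite Tx E ltxx.
- by rewrite Tx E ltxx andbF.
- by rewrite Ty E ltxx.
- by rewrite Ty E ltxx andbF.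
Qed.

Lemma sum_transfer f x y t : \sum_u transfer f x y t u = \sum_u f u.
Proof.
have delta v : \sum_(u : G) (u == v)%:R = 1 :> R.
  by rewrite (bigD1 v) //= eqxx big1 ?addr0 // => u /negPf ->.
by rewrite big_split /= -mulr_sumr sumrB !delta subrr mulr0 addr0.
Qed.

(** Induction on the number of fractional values. It stops at one, since a transfer takes two
    fractional points. *)
Lemma exists_rounding f : (forall u, 0 <= f u <= 1) -> exists g,
  [/\ forall u, 0 <= g u <= 1, \sum_u g u = \sum_u f u, ap3nt g <= ap3nt f
    & (#|frac g| <= 1)%N].
Proof.
move: {2}#|frac f| (leqnn #|frac f|) => k; elim: k f => [|k IH] f fk f01.
  by exists f; split=> //; rewrite (leq_trans fk).
have [le1|/card_gt1P [x [y [fx fy xy]]]] := leqP #|frac f| 1; first by exists f.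
have [L L_le] := transfer_concave (fun u => proj1 (andP (f01 u))) xy.
have [t [tL t01 card_lt]] := exists_rounding_step L f01 fx fy xy.
have [|g [g01 gsum gle gcard]] := IH _ _ t01.
  by rewrite -ltnS (leq_trans card_lt).
exists g; split=> //; first by rewrite gsum sum_transfer.
by apply: le_trans gle (le_trans (L_le t) _); rewrite gerDl.
Qed.

(** The sum bounds the number of progressions through [x], which is the price of altering a function
    at that single point. *)
Lemma ap3_delta (x : G) : \sum_(m : G) \sum_(d : G)
    ((m == x)%:R + (m + d == x)%:R + (m + d *+ 2 == x)%:R) = 3 * (p ^ n)%:R :> R.
Proof.
have delta v : \sum_(u : G) (u == v)%:R = 1 :> R.
  by rewrite (bigD1 v) //= eqxx big1 ?addr0 // => u /negPf ->.
rewrite exchange_big /=.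
have shift d : \sum_(m : G) (m + d == x)%:R = 1 :> R.
  rewrite -[RHS](delta (x - d)); apply: eq_bigr => m _.
  by rewrite -[x in LHS](subrK d) (inj_eq (addIr d)).
have inner d : \sum_(m : G)
    ((m == x)%:R + (m + d == x)%:R + (m + d *+ 2 == x)%:R) = 3 :> R.
  by rewrite big_split big_split /= !shift delta; ring.
rewrite (eq_bigr _ (fun d _ => inner d)) sumr_const card_mx card_Fp //.
by rewrite mul1n mulr_natr.
Qed.

(** The last fractional value is rounded up to 1, so no mass is lost. This affects at most
    [3 * p ^ n] progressions, and those with zero difference add at most [p ^ n]. *)
Lemma exists_set_of_function f : (forall u, 0 <= f u <= 1) ->
  exists S : {set G}, let s u := (u \in S)%:R in
    \sum_u f u <= #|S|%:R /\ ap3 s s s <= ap3 f f f + 4 * (p ^ n)%:R.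
Proof.
move=> f01; have [g [g01 gsum gle gcard]] := exists_rounding f01.
have [x gx] : exists x, forall u, u != x -> (g u == 0) || (g u == 1).
  have key u : u \notin frac g -> (g u == 0) || (g u == 1).
    by rewrite !inE negb_and -!leNgt !eq_le; case/andP: (g01 u) => -> ->; rewrite andbT.
  have [fr0|[x xfr]] := set_0Vmem (frac g).
    (* With no fractional value left, the exceptional point is arbitrary. *)
    by exists 0 => u _; apply: key; rewrite fr0 inE.
  exists x => u ux; apply: key; apply: contraNN ux => ufr.
  by have /card_le1P /(_ _ xfr) /(_ u) := gcard; rewrite ufr inE => <-.
exists [set u | 0 < g u] => s.
have sE u : s u = if u == x then s u else g u.
  case: eqVneq => // ux; rewrite /s inE.
  by case/orP: (gx u ux) => /eqP ->; rewrite ?ltxx ?ltr01.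
have s01 u : 0 <= s u <= 1 by rewrite /s; case: (u \in _); rewrite ?lexx ?ler01.
have gs u : g u <= s u.
  rewrite sE; case: eqP => // _; rewrite /s inE; have [_|] := ltP 0 (g u) => //.
  by case/andP: (g01 u).
have sumS : #|[set u | 0 < g u]|%:R = \sum_u s u.
  by rewrite -sum1_card natr_sum big_mkcond; apply: eq_bigr => u _; rewrite /s; case: (u \in _).
split; first by rewrite sumS -gsum; apply: ler_sum.
have P_ge : \sum_u s u ^+ 3 <= (p ^ n)%:R.
  have -> : (p ^ n)%:R = \sum_(x : G) 1 :> R.
    by rewrite sumr_const card_mx card_Fp ?mul1n.
  by apply: ler_sum => u _; case/andP: (s01 u) => ? ?; rewrite exprn_ile1.
have f3 : 0 <= \sum_u f u ^+ 3.
  by apply: sumr_ge0 => u _; rewrite exprn_ge0 //; case/andP: (f01 u).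
suff : ap3nt s <= ap3nt g + 3 * (p ^ n)%:R by rewrite !ap3_split; lra.
rewrite -(ap3_delta x) -big_split; apply: ler_sum => m _ /=.
rewrite [X in _ <= _ + X](bigID (fun d => d != 0)) /= addrA -big_split /=.
rewrite -[leLHS]addr0; apply: lerD; last by apply: sumr_ge0 => d _; rewrite !addr_ge0.
apply: ler_sum => d _.
have s0 u : 0 <= s u by case/andP: (s01 u).
have g0 u : 0 <= g u by case/andP: (g01 u).
have s1 u : s u <= 1 by case/andP: (s01 u).
have s3 : s m * s (m + d) * s (m + d *+ 2) <= 1 by rewrite !mulr_ile1 ?mulr_ge0.
have g3 : 0 <= g m * g (m + d) * g (m + d *+ 2) by rewrite !mulr_ge0.
have [b|] := boolP [|| m == x, m + d == x | m + d *+ 2 == x].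
  apply: le_trans s3 _; rewrite -[leLHS]add0r lerD //.
  rewrite -!natrD ler1n; move: b.
  by case: (m == x); case: (m + d == x); case: (m + d *+ 2 == x).
rewrite !negb_or => /and3P [/negPf a /negPf b /negPf c].
by rewrite (sE m) (sE (m + d)) (sE (m + d *+ 2)) a b c !addr0.
Qed.

End Rounding.

(** * Perturbation along a linear form *)

Section Perturbation.
Variables (R : realFieldType) (p : nat) (p_pr : prime p) (p_odd : odd p).

(** Each factor [p^-1 - [. = 0]] has mean 0, and any two of s, s+t, s+2t are independent and
    uniform. Only the products of three [A]s and of three [B]s survive. *)
Lemma sum_Fp_perturb (A0 A1 A2 B0 B1 B2 : R) :
  \sum_(s : 'F_p) \sum_(t : 'F_p) (A0 + B0 * (p%:R^-1 - (s == 0)%:R)) *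
     (A1 + B1 * (p%:R^-1 - (s + t == 0)%:R)) *
     (A2 + B2 * (p%:R^-1 - (s + t *+ 2 == 0)%:R)) =
  p%:R ^+ 2 * (A0 * A1 * A2) - (1 - p%:R^-1) * (B0 * B1 * B2).
Proof.
have p_neq0 : p%:R != 0 :> R by rewrite pnatr_eq0 -lt0n prime_gt0.
have card1 : \sum_(t : 'F_p) 1 = p%:R :> R by rewrite sumr_const card_Fp.
have delta v : \sum_(u : 'F_p) (u == v)%:R = 1 :> R.
  by rewrite (bigD1 v) //= eqxx big1 ?addr0 // => u /negPf ->.
have shift d : \sum_(s : 'F_p) (s + d == 0)%:R = 1 :> R.
  by rewrite -[RHS](delta (- d)); apply: eq_bigr => s _; rewrite addr_eq0.
have two t : (t *+ 2 == 0) = (t == 0 :> 'F_p).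
  by rewrite -mulr_natl mulf_eq0 (negPf (Fp_two_neq0 p_pr p_odd)).
(* With a_i = A_i + B_i / p the factors are a_i - B_i [s + i t = 0], and any
   two of the three indicators vanish together exactly at s = t = 0. *)
pose a0 := A0 + B0 / p%:R; pose a1 := A1 + B1 / p%:R; pose a2 := A2 + B2 / p%:R.
transitivity (\sum_(s : 'F_p) \sum_(t : 'F_p) (a0 * a1 * a2
  - B0 * a1 * a2 * (s == 0)%:R - a0 * B1 * a2 * (s + t == 0)%:R
  - a0 * a1 * B2 * (s + t *+ 2 == 0)%:R
  + (B0 * B1 * a2 + B0 * a1 * B2 + a0 * B1 * B2 - B0 * B1 * B2) * ((s == 0)%:R * (t == 0)%:R))).
  apply: eq_bigr => s _; apply: eq_bigr => t _; rewrite /a0 /a1 /a2.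
  have [->|s0] := eqVneq s 0.
    by rewrite !add0r two; case: (t == 0); rewrite /=; ring.
  have [st|st] := eqVneq (s + t) 0; last by rewrite /=; ring.
  have -> : (s + t *+ 2 == 0) = false; last by rewrite /=; ring.
  by rewrite mulr2n addrA st add0r; apply: contraNF s0 => /eqP t0; rewrite -st t0 addr0.
have S0 : \sum_(s : 'F_p) \sum_(t : 'F_p) (s == 0)%:R = p%:R :> R.
  by rewrite exchange_big -[RHS]card1; apply: eq_bigr => t _ /=; rewrite delta.
have S1 : \sum_(s : 'F_p) \sum_(t : 'F_p) (s + t == 0)%:R = p%:R :> R.
  by rewrite exchange_big -[RHS]card1; apply: eq_bigr => t _ /=; rewrite shift.
have S2 : \sum_(s : 'F_p) \sum_(t : 'F_p) (s + t *+ 2 == 0)%:R = p%:R :> R.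
  by rewrite exchange_big -[RHS]card1; apply: eq_bigr => t _ /=; rewrite shift.
have S3 : \sum_(s : 'F_p) \sum_(t : 'F_p) (s == 0)%:R * (t == 0)%:R = 1 :> R.
  by under eq_bigr => s _ do rewrite -mulr_sumr delta mulr1; rewrite delta.
have S4 : \sum_(s : 'F_p) \sum_(t : 'F_p) 1 = p%:R ^+ 2 :> R.
  by under eq_bigr => s _ do rewrite card1; rewrite sumr_const card_Fp // -[LHS]mulr_natr.
have -> : \sum_(s : 'F_p) \sum_(t : 'F_p) (a0 * a1 * a2
    - B0 * a1 * a2 * (s == 0)%:R - a0 * B1 * a2 * (s + t == 0)%:R
    - a0 * a1 * B2 * (s + t *+ 2 == 0)%:R
    + (B0 * B1 * a2 + B0 * a1 * B2 + a0 * B1 * B2 - B0 * B1 * B2) *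
      ((s == 0)%:R * (t == 0)%:R))
  = a0 * a1 * a2 * (\sum_(s : 'F_p) \sum_(t : 'F_p) 1)
    - B0 * a1 * a2 * (\sum_(s : 'F_p) \sum_(t : 'F_p) (s == 0)%:R)
    - a0 * B1 * a2 * (\sum_(s : 'F_p) \sum_(t : 'F_p) (s + t == 0)%:R)
    - a0 * a1 * B2 * (\sum_(s : 'F_p) \sum_(t : 'F_p) (s + t *+ 2 == 0)%:R)
    + (B0 * B1 * a2 + B0 * a1 * B2 + a0 * B1 * B2 - B0 * B1 * B2) *
      (\sum_(s : 'F_p) \sum_(t : 'F_p) (s == 0)%:R * (t == 0)%:R).
  rewrite !mulr_sumr -!sumrB -big_split /=.
  apply: eq_bigr => s _; rewrite !mulr_sumr -!sumrB -big_split /=.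
  by apply: eq_bigr => t _; rewrite mulr1.
rewrite S0 S1 S2 S3 S4.
by rewrite /a0 /a1 /a2; field.
Qed.

Variable n : nat.
Local Notation G := 'rV['F_p]_n.
Implicit Types (f : G -> R) (W : {vspace G}).

Lemma sum_avg_line f (w : G) :
  p%:R * \sum_x f x = \sum_x \sum_(s : 'F_p) f (x + s *: w).
Proof.
rewrite exchange_big /= mulr_natl -[X in _ *+ X](card_Fp p_pr) -sumr_const.
by apply: eq_bigr => s _; rewrite [LHS](reindex_inj (addIr (s *: w))).
Qed.

(** For values in [0, 1], the largest amplitude by which [f x] can move both up and down inside
    [0, 1]. *)
Definition dist_bool f x := Num.min (f x) (1 - f x).

Lemma exists_perturbation W f : (0 < \dim W)%N -> (forall x, 0 <= f x <= 1) ->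
  (forall x w, w \in W -> f (x + w) = f x) ->
  exists F : G -> R, [/\ forall x, 0 <= F x <= 1, \sum_x F x = \sum_x f x &
    p%:R ^+ 2 * ap3 F F F = p%:R ^+ 2 * ap3 f f f -
      (1 - p%:R^-1) * ap3 (dist_bool f) (dist_bool f) (dist_bool f)].
Proof.
move=> W_gt0 f01 fW; pose phi := dist_bool f.
have p_gt1 : 1 < p%:R :> R by rewrite ltr1n prime_gt1.
have p_gt0 : 0 < p%:R :> R by rewrite ltr0n prime_gt0.
have p_neq0 : p%:R != 0 :> R by rewrite gt_eqF.
have pV0 : 0 < p%:R^-1 :> R by rewrite invr_gt0.
have pV1 : p%:R^-1 <= 1 :> R by rewrite invf_le1 // ltW.
have [w [wW w0]] : exists w, w \in W /\ w != 0.
  exists (vpick W); rewrite memv_pick; split=> //.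
  by rewrite vpick0 -dimv_eq0 -lt0n.
have [a aw] := dot_eq1 w0.
have phiW x v : v \in W -> phi (x + v) = phi x by move=> vW; rewrite /phi /dist_bool fW.
have phi0 x : 0 <= phi x by have /andP [] := f01 x; rewrite le_min subr_ge0 => -> ->.
have phi1 x : phi x <= f x by rewrite /phi /dist_bool ge_min lexx.
have phi2 x : phi x <= 1 - f x by rewrite /phi /dist_bool ge_min lexx orbT.
pose F x := f x + phi x * (p%:R^-1 - (dot a x == 0)%:R).
have FE x s : F (x + s *: w) = f x + phi x * (p%:R^-1 - (dot a x + s == 0)%:R).
  by rewrite /F fW ?phiW ?memvZ // dotDr dotZr aw mulr1.
exists F; split.
- move=> x; have := phi1 x; have := phi2 x; have := f01 x.
  have := mulr_ge0 (phi0 x) (ltW pV0); have := ler_piMr (phi0 x) pV1; have := phi0 x.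
  rewrite /F mulrBr; case: (dot a x == 0); rewrite /= ?mulr1 ?mulr0; lra.
- apply: (mulfI p_neq0); rewrite (sum_avg_line F w) mulr_sumr; apply: eq_bigr => x _.
  (* As [dot a w = 1], this shift makes [s] the value of the linear form at the point of the
     line. *)
  rewrite (reindex_inj (addrI (- dot a x))) /=.
  under eq_bigr => s _ do rewrite FE addrA subrr add0r mulrBr.
  rewrite big_split sumrB /= !sumr_const card_Fp // -mulr_sumr.
  have -> : \sum_(s : 'F_p) (s == 0)%:R = 1 :> R.
    by rewrite (bigD1 0) //= big1 ?addr0 // => s /negPf ->.
  by rewrite -[_ / _ *+ p]mulr_natr mulfVK // mulr1 subrr addr0 mulr_natl.
(* [m] and [d] are moved along [w], where [f] and [phi] are constant. After recentring, the form
   takes the values s, s+t, s+2t on the three terms, and the sum over s and t is that of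
   [sum_Fp_perturb]. *)
transitivity (\sum_m \sum_d \sum_(s : 'F_p) \sum_(t : 'F_p)
    (f m + phi m * (p%:R^-1 - (s == 0)%:R)) *
    (f (m + d) + phi (m + d) * (p%:R^-1 - (s + t == 0)%:R)) *
    (f (m + d *+ 2) + phi (m + d *+ 2) * (p%:R^-1 - (s + t *+ 2 == 0)%:R))).
  rewrite expr2 -mulrA (sum_avg_line (fun m => \sum_d F m * F (m + d) * F (m + d *+ 2)) w).
  rewrite mulr_sumr; apply: eq_bigr => m _.
  rewrite mulr_sumr [RHS]exchange_big [LHS](reindex_inj (addrI (- dot a m))) /=.
  apply: eq_bigr => s _.
  rewrite (sum_avg_line (fun d => F _ * F (_ + d) * F (_ + d *+ 2)) w).
  apply: eq_bigr => d _; rewrite [LHS](reindex_inj (addrI (- dot a d))) /=.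
  apply: eq_bigr => t _; rewrite FE addrA subrr add0r.
  have -> : m + (- dot a m + s) *: w + (d + (- dot a d + t) *: w) =
     (m + d) + ((- dot a m + s) + (- dot a d + t)) *: w by rewrite [in RHS]scalerDl addrACA.
  have -> : m + (- dot a m + s) *: w + (d + (- dot a d + t) *: w) *+ 2 =
     (m + d *+ 2) + ((- dot a m + s) + (- dot a d + t) *+ 2) *: w.
    by rewrite [in RHS]scalerDl -scalerMnl mulrnDl addrACA.
  have E1 : dot a (m + d) + ((- dot a m + s) + (- dot a d + t)) = s + t.
    by rewrite dotDr; ring.
  have E2 : dot a (m + d *+ 2) + ((- dot a m + s) + (- dot a d + t) *+ 2) = s + t *+ 2.
    by rewrite dotDr dotMn; ring.
  by rewrite !FE E1 E2.
rewrite /ap3 !mulr_sumr -sumrB; apply: eq_bigr => m _.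
by rewrite !mulr_sumr -sumrB; apply: eq_bigr => d _; rewrite sum_Fp_perturb.
Qed.

End Perturbation.

(** * Critical sets *)

Section CriticalSets.
Variables (R : realType) (p : nat) (p_pr : prime p) (p_odd : odd p).

(** Majority vote on each coset of [W]: the proportion of a coset where [S] and the vote disagree is
    the smaller of the density and its complement. *)
Lemma approx_by_cosets n (W : {vspace 'rV['F_p]_n}) (S : {set 'rV['F_p]_n}) :
  let s u : R := (u \in S)%:R in
  exists A : {set 'rV['F_p]_n}, (#|A| <= p ^ (n - \dim W))%N /\
    #|symdiff S (sumset A W)|%:R = \sum_x dist_bool (avg W s) x.
Proof.
move=> s; pose T : {set 'rV['F_p]_n} := [set x | 2^-1 <= avg W s x].
have TW x w : w \in W -> (x + w \in T) = (x \in T) by move=> wW; rewrite !inE avg_inv.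
have s01 y : 0 <= s y <= 1 by rewrite /s; case: (y \in S); rewrite ?lexx ?ler01.
have W_gt0 := card_vspace_gt0 R p_pr W.
(* A complement of W meets every coset of W exactly once. *)
pose A : {set 'rV['F_p]_n} := [set x in T | x \in (W^C)%VS].
have AW : sumset A W = T.
  apply/setP => x; apply/imset2P/idP => [[a w]|xT].
    by rewrite [a \in A]finset.in_set => /andP[aT _] wW ->; rewrite TW.
  have : x \in (W + W^C)%VS by rewrite addv_complf memvf.
  case/memv_addP => w wW [c cW xE]; exists c w => //; last by rewrite addrC.
  by rewrite [c \in A]finset.in_set cW andbT; move: xT; rewrite xE addrC TW.
exists A; split.
  have -> : (n - \dim W)%N = \dim (W^C)%VS.
    by rewrite dimv_compl dimvf dim_matrix mul1r.
  rewrite -[X in (X ^ _)%N](card_Fp p_pr) -card_vspace subset_leq_card //.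
  by apply/fintype.subsetP => x; rewrite inE => /andP[].
rewrite AW; pose g u : R := (u \in symdiff S T)%:R.
have -> : #|symdiff S T|%:R = \sum_x g x.
  by rewrite -sum1_card natr_sum big_mkcond; apply: eq_bigr => u _; rewrite /g; case: (u \in _).
rewrite -(sum_avg p_pr W g); apply: eq_bigr => x _; rewrite /dist_bool.
have [xT|xT] := boolP (x \in T).
  have gE w : w \in W -> g (x + w) = 1 - s (x + w).
    move=> wW; rewrite /g /s finset.in_setU !finset.in_setD TW // xT /=.
    by case: (_ \in S); rewrite /= ?subrr ?subr0.
  have -> : avg W g x = 1 - avg W s x.
    rewrite /avg (eq_bigr _ gE) sumrB sumr_const mulrBr mulVf ?gt_eqF //.
  by rewrite inE in xT; rewrite min_r //; lra.
have gE w : w \in W -> g (x + w) = s (x + w).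
  move=> wW; rewrite /g /s finset.in_setU !finset.in_setD TW // (negPf xT) /=.
  by case: (_ \in S).
rewrite /avg (eq_bigr _ gE) -/(avg W s x) min_l //.
by rewrite inE -ltNge in xT; lra.
Qed.

Definition critical (alpha : R) n (S : {set 'rV['F_p]_n}) : Prop :=
  alpha * (p ^ n)%:R <= #|S|%:R /\
  forall S' : {set 'rV['F_p]_n},
    alpha * (p ^ n)%:R <= #|S'|%:R -> Lambda3 R S <= Lambda3 R S'.

Lemma critical_structure (alpha eps : R) : 0 < eps ->
  exists K N : nat, forall n (S : {set 'rV['F_p]_n}), (N <= n)%N -> critical alpha S ->
  exists (W : {vspace 'rV['F_p]_n}) (A : {set 'rV['F_p]_n}),
    [/\ (n <= \dim W + K)%N, (#|A| <= p ^ (n - \dim W))%N &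
      #|symdiff S (sumset A W)|%:R <= eps * (p ^ n)%:R].
Proof.
move=> eps_gt0; have [delta delta_gt0 varn] := varnavides p_pr p_odd eps_gt0.
have p_gt0 : 0 < p%:R :> R by rewrite ltr0n prime_gt0.
have p_neq0 : p%:R != 0 :> R by rewrite gt_eqF.
have kap_gt0 : 0 < 1 - p%:R^-1 :> R.
  by rewrite subr_gt0 invf_lt1 // ltr1n prime_gt1.
(* Perturbing gains at least [c * P^2]. The choice of [th] makes the regularity loss [6 * th * P^2]
   equal to [c / 4 * P^2], and the choice of [N] makes the rounding loss [4 * P] less than
   [c / 2 * P^2]. The total is below the gain, which contradicts minimality. *)
pose c := (1 - p%:R^-1) * delta / p%:R ^+ 2.
have c_gt0 : 0 < c by rewrite divr_gt0 ?mulr_gt0 ?exprn_gt0.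
pose th := c / 24; have th_gt0 : 0 < th by rewrite divr_gt0.
pose K := Num.Def.archi_bound (th ^- 2); pose N := Num.Def.archi_bound (8 / c).
have K_gt : th ^- 2 < K%:R by apply: archi_boundP; rewrite invr_ge0 sqr_ge0.
have N_gt : 8 / c < N%:R by apply: archi_boundP; rewrite divr_ge0 ?ltW.
(* The summand [K.+1] ensures [0 < \dim W], so that some linear form is nonconstant on [W]. *)
exists K, (N + K.+1)%N => n S nN [Salpha Smin].
set P : R := (p ^ n)%:R.
have P_gt0 : 0 < P by rewrite ltr0n expn_gt0 prime_gt0.
have P_big : 8 < c * P.
  rewrite mulrC -ltr_pdivrMr //; apply: lt_trans N_gt _; rewrite ltr_nat.
  by apply: leq_ltn_trans (ltn_expl n (prime_gt1 p_pr)); rewrite (leq_trans _ nN) ?leq_addr.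
pose s u : R := (u \in S)%:R.
have s01 u : 0 <= s u <= 1 by rewrite /s; case: (u \in S); rewrite ?lexx ?ler01.
have Lambda3E (S' : {set 'rV['F_p]_n}) : Lambda3 R S' =
    (P ^+ 2)^-1 * ap3 (fun u => (u \in S')%:R) (fun u => (u \in S')%:R) (fun u => (u \in S')%:R).
  by [].
have [W [dimW regW]] := regularity p_pr p_odd th_gt0 s01.
have dimW' : (n <= \dim W + K)%N.
  by rewrite -(ler_nat R) natrD; lra.
have W_gt0 : (0 < \dim W)%N.
  by have := leq_trans (leq_addl N K.+1) (leq_trans nN dimW'); rewrite -add1n leq_add2r.
have [A [cardA symA]] := approx_by_cosets W S.
exists W, A; split=> //; rewrite symA leNgt; apply/negP => big.
set f := avg W s in big regW.
have f01 x : 0 <= f x <= 1 by apply: avg_itv.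
have phi01 x : 0 <= dist_bool f x <= 1.
  have /andP [f0 f1] := f01 x.
  by rewrite /dist_bool le_min ge_min f0 f1 subr_ge0 f1.
have Tphi := varn _ _ phi01 (ltW big).
have [F [F01 sumF TF]] := exists_perturbation p_pr p_odd W_gt0 f01 (fun x w => @avg_inv R p n W s x w).
have [S' [cardS' TS']] := exists_set_of_function p_pr p_odd F01.
have sumS : \sum_x F x = #|S|%:R.
  rewrite sumF sum_avg // -sum1_card natr_sum [RHS]big_mkcond.
  by apply: eq_bigr => u _; rewrite /s; case: (u \in S).
have := Smin S' (le_trans Salpha (le_trans _ cardS')).
rewrite sumS lexx => /(_ isT); rewrite !Lambda3E ler_pM2l ?invr_gt0 ?exprn_gt0 // => TSS'.
have TF' : ap3 F F F = ap3 f f f -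
    (1 - p%:R^-1) * ap3 (dist_bool f) (dist_bool f) (dist_bool f) / p%:R ^+ 2.
  by apply: (mulfI (expf_neq0 2 p_neq0)); rewrite TF; field.
have cT : c * P ^+ 2 <= (1 - p%:R^-1) * ap3 (dist_bool f) (dist_bool f) (dist_bool f) / p%:R ^+ 2.
  rewrite /c -mulrA [_^-1 * _]mulrC mulrA ler_pM2r ?invr_gt0 ?exprn_gt0 //.
  by rewrite -mulrA ler_pM2l.
have : 8 * P < c * P ^+ 2 by rewrite expr2 mulrA ltr_pM2r.
by move: TSS' TS' regW; rewrite TF' -/s /th -/P; lra.
Qed.

End CriticalSets.

(** * From a fixed accuracy to error functions tending to 0 *)

Local Open Scope classical_set_scope.
Local Open Scope ring_scope.

Lemma cvg_inv_succ_index (R : realType) (J : nat -> nat) :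
  (forall j, exists N, forall n, (N <= n)%N -> (j <= J n)%N) ->
  (fun n => (J n).+1%:R^-1 : R) @ \oo --> 0.
Proof.
move=> Jtop; apply/cvgrPdist_lt => e e_gt0.
pose j := Num.Def.archi_bound e^-1.
have j_gt : e^-1 < j%:R by apply: archi_boundP; rewrite invr_ge0 ltW.
have [N NJ] := Jtop j; exists N => // n /= /NJ jJ.
rewrite sub0r normrN ger0_norm ?invr_ge0 // invf_plt ?posrE //.
by rewrite (lt_le_trans j_gt) // ler_nat (leq_trans jJ).
Qed.

Theorem theorem1 (R : realType) (p : nat) (alpha : R) :
  prime p -> odd p -> 0 < alpha -> alpha <= 1 ->
  exists a b c : nat -> R,
    a @ \oo --> 0 /\ b @ \oo --> 0 /\ c @ \oo --> 0 /\
    forall (n : nat) (S : {set 'rV['F_p]_n}),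
      alpha * (p ^ n)%:R <= #|S|%:R ->
      (forall S' : {set 'rV['F_p]_n},
          alpha * (p ^ n)%:R <= #|S'|%:R -> Lambda3 R S <= Lambda3 R S') ->
      exists (W : {vspace 'rV['F_p]_n}) (A : {set 'rV['F_p]_n}),
        n%:R - a n * n%:R <= (\dim W)%:R /\
        #|A|%:R <= (p%:R : R) `^ (b n * n%:R) /\
        #|symdiff S (sumset A W)|%:R <= c n * (p ^ n)%:R.
Proof.
move=> p_pr p_odd alpha_gt0 alpha_le1.
(* Accuracy [1 / (j + 1)] for the codimension relative to [n] and for the symmetric difference,
   required of all critical sets in dimension [n] at once. *)
pose good n j := forall S : {set 'rV['F_p]_n}, critical alpha S ->
  exists (W : {vspace 'rV['F_p]_n}) (A : {set 'rV['F_p]_n}),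
    [/\ ((n - \dim W) * j.+1 <= n)%N, (#|A| <= p ^ (n - \dim W))%N &
      #|symdiff S (sumset A W)|%:R <= j.+1%:R^-1 * (p ^ n)%:R :> R].
(* Accuracy 1 is reached with [W] everything and [A] empty, so the maximum defining [J] runs over a
   nonempty set in every dimension. *)
have good0 n : good n 0%N.
  move=> S _; exists fullv, finset.set0; split.
  - by rewrite dimvf dim_matrix mul1r subnn.
  - by rewrite cards0.
  rewrite invr1 mul1r ler_nat /symdiff.
  have -> : sumset finset.set0 fullv = finset.set0 :> {set 'rV['F_p]_n}.
    by apply/setP => x; rewrite [RHS]inE; apply/imset2P => -[u v]; rewrite inE.
  rewrite finset.setD0 finset.set0D finset.setU0.
  by rewrite (leq_trans (max_card _)) // card_mx card_Fp // mul1n.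
have good_ev j : exists N, forall n, (N <= n)%N -> good n j.
  have [|K [N KN]] := @critical_structure R p p_pr p_odd alpha (j.+1%:R^-1).
    by rewrite invr_gt0.
  (* The codimension is at most [K], so [K * j.+1 <= n] makes it at most [n / (j + 1)]. *)
  exists (maxn N (K * j.+1)) => n; rewrite geq_max => /andP [Nn Kn] S critS.
  have [W [A [dimW cardA symA]]] := KN n S Nn critS.
  exists W, A; split=> //; apply: leq_trans Kn; rewrite leq_mul2r /=.
  by rewrite leq_subLR.
(* The best quality available in dimension n: it tends to infinity. *)
pose J n := (\max_(j < n.+1 | `[< good n j >]) j)%N.
have goodJ n : good n (J n).
  have nonempty : (0 < #|[pred j : 'I_n.+1 | `[< good n j >]]|)%N.
    by apply/card_gt0P; exists ord0; apply/asboolP; exact: good0.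
  have [j jgood JE] := eq_bigmax_cond (fun j : 'I_n.+1 => j : nat) nonempty.
  rewrite /J; have -> : (\max_(j < n.+1 | `[< good n j >]) j)%N = j by exact: JE.
  by move/asboolP: jgood.
have Jtop j : exists N, forall n, (N <= n)%N -> (j <= J n)%N.
  (* [j <= n] is also imposed because [J n] only considers indices up to [n]. *)
  have [N Ngood] := good_ev j; exists (maxn N j) => n.
  rewrite geq_max => /andP [Nn jn].
  have jlt : (j < n.+1)%N by rewrite ltnS.
  apply: (@leq_bigmax_cond _ (fun j : 'I_n.+1 => `[< good n j >]) (fun j => j : nat) (Ordinal jlt)).
  by apply/asboolP; exact: Ngood.
pose a n : R := (J n).+1%:R^-1.
have a0 : a @ \oo --> 0 := cvg_inv_succ_index Jtop.
(* A single function suffices: [n - \dim W] is both the codimension and the exponent bounding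
   [#|A|]. *)
exists a, a, a; do 3!split=> //; move=> n S Sge Smin.
have [W [A [dimW cardA symA]]] := goodJ n S (conj Sge Smin).
have dimW_le : (n - \dim W)%:R <= a n * n%:R.
  by rewrite mulrC ler_pdivlMr // -natrM ler_nat.
exists W, A; split; last split=> //.
  rewrite lerBlDl; apply: le_trans (lerD dimW_le (lexx _)).
  by rewrite -natrD ler_nat addnC -leq_subLR.
apply: le_trans (_ : p%:R `^ (n - \dim W)%:R <= _); last first.
  by rewrite ler_powR // ler1n prime_gt0.
by rewrite powR_mulrn ?ler0n // -natrX ler_nat.
Qed.
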